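(* Let $q$ be a prime power. For $b\in\mathbb{F}_{q^6}$ put $U_b=\{(x,\,bx^q+x^{q^4}) : x\in\mathbb{F}_{q^6}\}\subseteq \mathbb{F}_{q^6}\times\mathbb{F}_{q^6}$. Under the action of $\mathrm{GL}(2,q^6)$ there are exactly $\lfloor (q^2+q+1)(q-2)/2\rfloor$ equivalence classes of maximum scattered subspaces of the form $U_b$, $b\in\mathbb{F}_{q^6}$, in $\mathbb{F}_{q^6}\times\mathbb{F}_{q^6}$.
   Context: An $\mathbb{F}_q$-subspace $U$ of $V=\mathbb{F}_{q^6}\times\mathbb{F}_{q^6}$ is called scattered if $\dim_{\mathbb{F}_q}(U\cap \langle \mathbf{u}\rangle_{\mathbb{F}_{q^6}})\le 1$ for every nonzero $\mathbf{u}\in V$; it is maximum scattered if moreover $\dim_{\mathbb{F}_q}U=6$ (each $U_b$ has $\mathbb{F}_q$-dimension $6$). Two $\mathbb{F}_q$-subspaces $U,W$ of $V$ are $\mathrm{GL}(2,q^6)$-equivalent if $\varphi(U)=W$ for some $\varphi\in\mathrm{GL}(2,q^6)$, the group of invertible $\mathbb{F}_{q^6}$-linear maps of $V$. *)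

(* Defs.v *)
From HB Require Import structures.
From mathcomp Require Import all_boot all_order all_algebra.
From mathcomp Require Import all_fingroup all_field.

Set Implicit Arguments.
Unset Strict Implicit.
Unset Printing Implicit Defensive.

Import GRing.Theory.
Local Open Scope ring_scope.

(* finvect_type L is convertible to L: it only adds the finType structure of a
   finite-dimensional vector space over a finite field. *)
Notation plane L := (finvect_type L * finvect_type L)%type.

Section ScatteredSubspaces.

Variables (F : finFieldType) (L : fieldExtType F).
Notation fL := (finvect_type L).
Notation V := (plane L).
Implicit Types (k : F) (a b x y : fL) (u v w : V) (S : {vspace V})
  (A B : {set V}) (phi : {perm V}).

(* The scaling *: of V is by F, this one is by L. *)
Definition Lscale a u : V := (a * u.1, a * u.2).

Lemma Lscale_linear u : linear (Lscale^~ u).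
Proof. by move=> k a b; rewrite /Lscale !mulrDl -!scalerAl. Qed.

Definition Lscale_at u a : V := Lscale a u.
HB.instance Definition _ u :=
  GRing.isLinear.Build F fL V *:%R (Lscale_at u) (Lscale_linear u).

Definition Lspan u : {vspace V} := limg (linfun (Lscale_at u)).

Lemma mem_LspanP u v : reflect (exists a, v = Lscale a u) (v \in Lspan u).
Proof.
by apply: (iffP memv_imgP) => [[a _ ->]|[a ->]]; exists a;
   rewrite ?memvf ?lfunE.
Qed.

Definition scattered S :=
  [forall u : V, (u != 0) ==> (\dim (S :&: Lspan u) <= 1)%N].

Definition max_scattered S := scattered S && (\dim S == 6).

Definition U_fun b x : V := (x, b * x ^+ #|F| + x ^+ (#|F| ^ 4)).

Lemma exp_card_linear n : linear (fun x => x ^+ (#|F| ^ n)).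
Proof.
have [p _ pcharF] := finPcharP F.
have pcharL : p \in [pchar fL] by rewrite (pchar_lalg fL).
move=> k x y /=; elim: n => [|n IHn]; first by rewrite !expn0 !expr1.
rewrite expnSr !exprM {}IHn; move: (x ^+ _) (y ^+ _) => {}x {}y.
rewrite -[in RHS](expf_card k) -exprZn; move: (k *: x) => {k}x.
rewrite (card_pprimeChar pcharF).
elim: (logn _ _) => [|m IHm]; first by rewrite !expn0 !expr1.
by rewrite expnSr !exprM {}IHm -pFrobenius_autE rmorphD.
Qed.

Lemma U_fun_linear b : linear (U_fun b).
Proof.
move=> k x y; rewrite /U_fun exp_card_linear.
have := exp_card_linear 1 k x y; rewrite expn1 => ->.
congr pair => /=.
by rewrite mulrDr -scalerAr addrACA scalerDr.
Qed.

HB.instance Definition _ b :=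
  GRing.isLinear.Build F fL V *:%R (U_fun b) (U_fun_linear b).

Definition U_ b : {vspace V} := limg (linfun (U_fun b)).

Lemma mem_UP b v :
  reflect (exists x, v = (x, b * x ^+ #|F| + x ^+ (#|F| ^ 4))) (v \in U_ b).
Proof.
by apply: (iffP memv_imgP) => [[x _ ->]|[x ->]]; exists x;
   rewrite ?memvf ?lfunE.
Qed.

(* Invertibility is built into {perm V}. *)
Definition GL2 : {set {perm V}} :=
  [set phi : {perm V} | [forall a, forall u, forall v,
     phi (Lscale a u + v) == Lscale a (phi u) + phi v]].

Definition GL2_equiv : rel {set V} :=
  fun A B => [exists phi in GL2, phi @: A == B].

Lemma GL2P phi :
  reflect (forall a u v, phi (Lscale a u + v) = Lscale a (phi u) + phi v)
          (phi \in GL2).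
Proof.
rewrite inE; apply: (iffP forallP) => [H a u v|H a].
  by move/forallP: (H a) => /(_ u)/forallP/(_ v)/eqP.
by apply/forallP => u; apply/forallP => v; rewrite H.
Qed.

Lemma GL2_group_set : group_set GL2.
Proof.
apply/group_setP; split=> [|phi psi /GL2P Hphi /GL2P Hpsi].
  by apply/GL2P => a u v; rewrite !perm1.
by apply/GL2P => a u v; rewrite !permM Hphi Hpsi.
Qed.

Canonical GL2_group := Group GL2_group_set.

Lemma GL2_equiv_equivalence : equivalence_rel GL2_equiv.
Proof.
have refl A : GL2_equiv A A.
  apply/existsP; exists 1%g; rewrite group1 /=; apply/eqP.
  by rewrite -[RHS]imset_id; apply: eq_imset => u; rewrite perm1.
have sym A B : GL2_equiv A B -> GL2_equiv B A.
  case/existsP => phi /andP[Gphi /eqP <-]; apply/existsP; exists phi^-1%g.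
  rewrite groupV Gphi -imset_comp /=; apply/eqP.
  by rewrite -[RHS]imset_id; apply: eq_imset => u /=; rewrite permK.
have trans B A C : GL2_equiv A B -> GL2_equiv B C -> GL2_equiv A C.
  case/existsP => phi /andP[Gphi /eqP <-] /existsP[psi /andP[Gpsi /eqP <-]].
  apply/existsP; exists (phi * psi)%g; rewrite groupM //= -imset_comp.
  by apply/eqP/eq_imset => u /=; rewrite permM.
move=> A B C; split=> [|AB]; first exact: refl.
by apply/idP/idP; apply: trans => //; apply: sym.
Qed.

Definition max_scattered_Us : {set {set V}} :=
  [set [set v in U_ b] | b : fL & max_scattered (U_ b)].

End ScatteredSubspaces.

Arguments GL2_equiv {F} L.
Arguments max_scattered_Us {F} L.

(* Main.v *)
(* Write s for x |-> x^q, w_i = s^i(w), K = F_{q^3}, f_b(x) = b x_1 + x_4 and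
   N(b) = b b_3. Comparing coefficients of q-polynomials, U_b and U_b' are
   GL(2,q^6)-equivalent iff N(b) = N(b'), so one has to count the n = N(b) in K
   for which U_b is scattered. The space U_b is not scattered iff
   f_b(w u) = w f_b(u) for some u <> 0 and w outside F_q; eliminating u with
   Hilbert 90, this says n = 1, or n = 0, or n is the cross ratio X(w) of
   w_4, w_1, w_0, w_3 for some w of degree 6 over F_q.
   To count the values of X, let c(w) be the cross ratio of w_0, w_2, w_3, w_1.
   If c(w) = c(w'), the projectivity sending w_i to w'_i for i = 0, 1, 2, 3
   commutes with s, so the fibres of c are the free PGL(2,q)-orbits, of size
   q^3 - q, and c takes q^3 + q - 1 values. Moreover X = 1 - c s(c), and
   c - 1, s^3(c - 1) are the roots of a quadratic determined by X, so X is
   2-to-1 in c except at the values c in K. Finally c(w) in K means that the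
   pairs {w_i, w_{i+3}} are in involution, i.e. that 1, w + w_3 and w w_3 are
   linearly dependent over F_q; counting these w through the fibres of trace
   and norm from F_{q^6} to K gives q^2 such values for q odd and q^2 - 1 for
   q even. *)
Require Import Defs.
From HB Require Import structures.
From mathcomp Require Import all_boot all_order all_algebra all_fingroup all_field.
From mathcomp Require Import ring zify.

Set Implicit Arguments.
Unset Strict Implicit.
Unset Printing Implicit Defensive.

Import GRing.Theory.

(** * Cross ratios and the rational identities among those of six points *)

Section CrossRatio.
Local Open Scope ring_scope.
Variable (L : fieldType).
Implicit Types (a b c d k t : L) (w : nat -> L).

Definition cross_ratio a b c d := ((a - c) * (b - d)) / ((a - d) * (b - c)).

Lemma cross_ratio_affine t k a b c d : k != 0 ->
  cross_ratio (t + k * a) (t + k * b) (t + k * c) (t + k * d) =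
  cross_ratio a b c d.
Proof.
move=> k0; have E x y : t + k * x - (t + k * y) = k * (x - y) by ring.
by rewrite /cross_ratio !E !(mulrACA k _ k) -[LHS]mulf_div divff ?mul1r ?mulf_neq0.
Qed.

Lemma cross_ratio_inv a b c d : a != 0 -> b != 0 -> c != 0 -> d != 0 ->
  a - d != 0 -> b - c != 0 ->
  cross_ratio a^-1 b^-1 c^-1 d^-1 = cross_ratio a b c d.
Proof.
move=> a0 b0 c0 d0 ad bc; rewrite /cross_ratio; field.
by rewrite a0 b0 c0 d0 ad bc !mulN1r -opprB oppr_eq0 bc -opprB oppr_eq0 ad.
Qed.

Lemma eq_sum_prod x y x' y' : x + y = x' + y' :> L -> x * y = x' * y' ->
  x' = x \/ x' = y.
Proof.
move=> sE pE; have /eqP : (x' - x) * (x' - y) = 0.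
  have -> : (x' - x) * (x' - y) = x' * x' - x' * (x + y) + x * y by ring.
  by rewrite sE pE; ring.
by rewrite mulf_eq0 !subr_eq0 => /orP[] /eqP; [left|right].
Qed.

Definition distinct6 w :=
  forall i j, (i < 6)%N -> (j < 6)%N -> i != j -> w i - w j != 0.

Ltac field_distinct h :=
  field; repeat (apply/andP; split); exact: h.

(** In the product on the right the differences of w_2 with w_1 and w_3 cancel, which leaves a cross
    ratio of w_0, w_1, w_3, w_4; one minus it is the cross ratio with two points exchanged. *)
Lemma cross_ratio_chain w : distinct6 w ->
  cross_ratio (w 4) (w 1) (w 0) (w 3) =
  1 - cross_ratio (w 0) (w 2) (w 3) (w 1) * cross_ratio (w 1) (w 3) (w 4) (w 2).
Proof. by move=> h; rewrite /cross_ratio; field_distinct h. Qed.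

(** With [cross_ratio_sum], this yields the quadratic with roots c - 1 and s^3(c) - 1: both
    symmetric functions are expressed through X and its conjugates. *)
Lemma cross_ratio_prod w : distinct6 w ->
  (cross_ratio (w 0) (w 2) (w 3) (w 1) - 1) *
    (cross_ratio (w 3) (w 5) (w 0) (w 4) - 1) =
  cross_ratio (w 4) (w 1) (w 0) (w 3) * cross_ratio (w 0) (w 3) (w 2) (w 5).
Proof. by move=> h; rewrite /cross_ratio; field_distinct h. Qed.

Lemma cross_ratio_sum w (n0 := cross_ratio (w 4) (w 1) (w 0) (w 3))
    (n1 := cross_ratio (w 5) (w 2) (w 1) (w 4))
    (n2 := cross_ratio (w 0) (w 3) (w 2) (w 5)) : distinct6 w ->
  (1 - n1) * (cross_ratio (w 0) (w 2) (w 3) (w 1) - 1 +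
              (cross_ratio (w 3) (w 5) (w 0) (w 4) - 1)) =
  - ((1 - n1) * n0 * n2 + n0 + n2 - n0 * n2 - n1).
Proof.
by move=> h; rewrite /n0 /n1 /n2 /cross_ratio; field_distinct h.
Qed.

Lemma cross_ratio_neq01 w (n := cross_ratio (w 4) (w 1) (w 0) (w 3)) :
  distinct6 w -> (n != 0) && (n != 1).
Proof.
move=> h; rewrite /n /cross_ratio !mulf_neq0 ?invr_eq0 ?mulf_neq0 ?h //=.
rewrite -subr_eq0 (_ : _ - 1 = (w 4 - w 1) * (w 0 - w 3) /
  ((w 4 - w 3) * (w 1 - w 0))); last by field_distinct h.
by rewrite !mulf_neq0 ?invr_eq0 ?mulf_neq0 ?h.
Qed.

End CrossRatio.

(** * Cross ratios of the conjugates of w under an automorphism s with s^6 = 1 *)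

Section FrobeniusConjugates.
Local Open Scope ring_scope.
Variables (L : fieldType) (s : {rmorphism L -> L}).
Hypothesis s6 : forall x, iter 6 s x = x.
Implicit Types (w x y a k d : L).

(** The maximal proper subfields of F_{q^6} are the fixed fields of s^3 and s^2, so for s the
    q-power map this says that w generates F_{q^6} over F_q. *)
Definition degree6 w := (iter 3 s w != w) && (iter 2 s w != w).

Lemma degree6_nfix w : degree6 w -> s w != w.
Proof. by case/andP=> _; apply: contra => /eqP /= e; rewrite !e. Qed.

Let s6E x : s (s (s (s (s (s x))))) = x. Proof. exact: s6. Qed.

Lemma degree6_distinct w : degree6 w -> distinct6 (fun i => iter i s w).
Proof.
move=> Dw.
(* The cases n = 4 and n = 5 reduce to 2 and 1 because s^6 = 1. *)
have nz n : (0 < n < 6)%N -> iter n s w != w.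
  have [D3 D2] := andP Dw; have D1 := degree6_nfix Dw.
  case: n => [|[|[|[|[|[|n]]]]]] //= _.
    by apply: contraNN D2 => /eqP e; rewrite -[X in _ == X]s6E /= e.
  by apply: contraNN D1 => /eqP e; rewrite -[X in _ == X]s6E /= e.
have sh i n : (0 < n)%N -> (i + n < 6)%N -> iter (i + n) s w != iter i s w.
  move=> n0 lt; rewrite iterD; elim: i lt => [|i IH] lt.
    by apply: nz; rewrite n0.
  by rewrite !iterS (inj_eq (fmorph_inj s)) IH // ltnW.
move=> i j i6 j6 nij; rewrite subr_eq0; case: ltngtP nij => // lt _.
  by rewrite eq_sym -(subnKC (ltnW lt)) sh ?subn_gt0 // subnKC // ltnW.
by rewrite -(subnKC (ltnW lt)) sh ?subn_gt0 // subnKC // ltnW.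
Qed.

Lemma rmorph_cross_ratio a b c d :
  s (cross_ratio a b c d) = cross_ratio (s a) (s b) (s c) (s d).
Proof. by rewrite /cross_ratio fmorph_div !rmorphM !rmorphB. Qed.

(** This is c(w) of the opening outline, and [norm_ratio] is X(w). *)
Definition conj_ratio w := cross_ratio w (iter 2 s w) (iter 3 s w) (s w).
(* As w runs over the elements of degree 6, the value of norm_ratio runs over
   the norms, other than 0 and 1, of the b for which U_b is not scattered. *)
Definition norm_ratio w := cross_ratio (iter 4 s w) (s w) w (iter 3 s w).

Lemma rmorph_conj_ratio w : s (conj_ratio w) = conj_ratio (s w).
Proof. exact: rmorph_cross_ratio. Qed.

Lemma rmorph_norm_ratio w : s (norm_ratio w) = norm_ratio (s w).
Proof. exact: rmorph_cross_ratio. Qed.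

Lemma norm_ratio_fixed3 w : iter 3 s (norm_ratio w) = norm_ratio w.
Proof.
rewrite /= !rmorph_cross_ratio /= !s6E /norm_ratio /cross_ratio /=.
by congr (_ / _); apply: mulrC.
Qed.

Lemma norm_ratioE w : degree6 w -> norm_ratio w = 1 - conj_ratio w * s (conj_ratio w).
Proof.
by move=> Dw; rewrite rmorph_conj_ratio [LHS](cross_ratio_chain (degree6_distinct Dw)).
Qed.

Lemma norm_ratio_neq01 w : degree6 w -> (norm_ratio w != 0) && (norm_ratio w != 1).
Proof. move/degree6_distinct; exact: cross_ratio_neq01. Qed.

Lemma conj_ratio_prod w : degree6 w ->
  (conj_ratio w - 1) * (iter 3 s (conj_ratio w) - 1) =
  norm_ratio w * iter 2 s (norm_ratio w).
Proof.
move/degree6_distinct/cross_ratio_prod => /= e.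
by rewrite /= !rmorph_conj_ratio !rmorph_norm_ratio /conj_ratio /norm_ratio /= !s6E.
Qed.

Lemma conj_ratio_sum w (n0 := norm_ratio w) (n1 := s n0) (n2 := s n1) : degree6 w ->
  (1 - n1) * (conj_ratio w - 1 + (iter 3 s (conj_ratio w) - 1)) =
  - ((1 - n1) * n0 * n2 + n0 + n2 - n0 * n2 - n1).
Proof.
move/degree6_distinct/cross_ratio_sum => /= e.
rewrite /n2 /n1 /n0 /= !rmorph_conj_ratio !rmorph_norm_ratio.
by rewrite /conj_ratio /norm_ratio /= !s6E.
Qed.

(** X determines its conjugates, hence the sum and the product of c - 1 and s^3(c) - 1; dividing in
    the sum identity uses X <> 1. *)
Lemma conj_ratio_of_norm_ratio w w' :
  degree6 w -> degree6 w' -> norm_ratio w = norm_ratio w' ->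
  (conj_ratio w' = conj_ratio w) \/ (conj_ratio w' = iter 3 s (conj_ratio w)).
Proof.
move=> Dw Dw' e.
have [|||] := @eq_sum_prod L (conj_ratio w - 1) (iter 3 s (conj_ratio w) - 1)
  (conj_ratio w' - 1) (iter 3 s (conj_ratio w') - 1).
- apply: (@mulfI _ (1 - s (norm_ratio w))); last by rewrite {2}e !conj_ratio_sum // e.
  rewrite subr_eq0 eq_sym -(rmorph1 s) (inj_eq (fmorph_inj s)).
  by case/andP: (norm_ratio_neq01 Dw).
- by rewrite !conj_ratio_prod // e.
- by move/addIr; left.
- by move/addIr; right.
Qed.

(** Subtracting the relation from its image under s gives (w - s w)(w + s w + d) = 0; hence s w = -
    d - w, and applying s again gives s^2 w = w. *)
Lemma degree6_quad w d k : degree6 w -> s d = d -> s k = k ->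
  w * w + d * w <> k.
Proof.
move=> Dw sd sk e.
have /eqP : (w - s w) * (w + s w + d) = 0.
  have := congr1 s e; rewrite rmorphD !rmorphM sd sk -e => /esym/eqP.
  by rewrite -subr_eq0 => /eqP <-; ring.
rewrite mulf_eq0 subr_eq0 eq_sym (negPf (degree6_nfix Dw)) /= => /eqP z.
have := congr1 s z; rewrite !rmorphD sd rmorph0 -{}z => /addIr.
by rewrite addrC => /addIr /eqP; case/andP: Dw => _ /negPf /= ->.
Qed.

Lemma degree6_affine a k w : s a = a -> s k = k -> k != 0 ->
  degree6 (a + k * w) = degree6 w.
Proof.
move=> sa sk k0; rewrite /degree6 /= !(rmorphD, rmorphM, sa, sk).
by rewrite !(inj_eq (addrI _)) !(inj_eq (mulfI k0)).
Qed.

Lemma degree6_inv w : degree6 w^-1 = degree6 w.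
Proof. by rewrite /degree6 /= !fmorphV !(inj_eq invr_inj). Qed.

Lemma conj_ratio_affine a k w : s a = a -> s k = k -> k != 0 ->
  conj_ratio (a + k * w) = conj_ratio w.
Proof.
move=> sa sk k0; rewrite /conj_ratio /= !(rmorphD, rmorphM, sa, sk).
exact: cross_ratio_affine.
Qed.

Lemma degree6_neq0 w : degree6 w -> w != 0.
Proof. by move/degree6_nfix; apply: contraNneq => ->; rewrite rmorph0. Qed.

Lemma conj_ratio_inv w : degree6 w -> conj_ratio w^-1 = conj_ratio w.
Proof.
move=> Dw; have w0 := degree6_neq0 Dw; have h := degree6_distinct Dw.
rewrite /conj_ratio /= !fmorphV cross_ratio_inv ?fmorph_eq0 //.
  exact: (h 0 1).
exact: (h 2 3).
Qed.

Local Notation pole_fixed o := (if o is Some d then s d = d else True).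

(* Bruhat decomposition of PGL(2): each class is represented exactly once, with
   o the point sent to infinity up to sign (None when infinity is fixed). *)
Definition moebius o a k w := if o is Some d then a + k / (d + w) else a + k * w.

Lemma degree6_moebius o a k w :
    pole_fixed o -> s a = a -> s k = k -> k != 0 ->
  degree6 (moebius o a k w) = degree6 w.
Proof.
move=> so sa sk k0; case: o so => [d|] sd; rewrite /moebius degree6_affine //.
by rewrite degree6_inv -[w in LHS]mul1r degree6_affine ?rmorph1 ?oner_neq0.
Qed.

Lemma conj_ratio_moebius o a k w :
    pole_fixed o -> s a = a -> s k = k -> k != 0 ->
  degree6 w -> conj_ratio (moebius o a k w) = conj_ratio w.
Proof.
move=> so sa sk k0 Dw; case: o so => [d|] sd; rewrite /moebius conj_ratio_affine //.
rewrite conj_ratio_inv -[X in d + X]mul1r ?conj_ratio_affine ?degree6_affine //.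
- by rewrite rmorph1.
- exact: oner_neq0.
- by rewrite rmorph1.
- exact: oner_neq0.
Qed.

(** The action of PGL(2,q) is free: two different parameter triples would make w a root of a nonzero
    polynomial of degree at most 2 with coefficients fixed by s. *)
Lemma moebius_inj o o' a a' k k' w :
    pole_fixed o -> s a = a -> s k = k -> k != 0 ->
    pole_fixed o' ->
    s a' = a' -> s k' = k' -> k' != 0 -> degree6 w ->
  moebius o a k w = moebius o' a' k' w -> [/\ o = o', a = a' & k = k'].
Proof.
have lin x y z : s x = x -> s y = y -> degree6 z -> x * z = y -> x = 0 /\ y = 0.
  move=> sx sy Dz e; have [x0|x0] := eqVneq x 0; first by rewrite -e x0 mul0r.
  case/negP: (degree6_nfix Dz); rewrite -(inj_eq (mulfI x0)) -{1}sx -rmorphM e.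
  by rewrite sy.
have dif d b b' c c' z : s d = d -> s b = b -> s c = c -> s b' = b' ->
   s c' = c' -> c != 0 -> c' != 0 -> degree6 z ->
   b + c / (d + z) <> b' + c' * z.
  move=> sd sb sc sb' sc' c0 c'0 Dz e.
  have dz : d + z != 0.
    by rewrite -[z]mul1r degree6_neq0 ?degree6_affine ?rmorph1 ?oner_neq0.
  (* These are the coefficients of the monic quadratic obtained by clearing the denominator d + z
     and dividing by c'. *)
  apply: (degree6_quad (d := d + (b' - b) / c')
    (k := (c + (b - b') * d) / c') Dz).
  - by rewrite rmorphD fmorph_div rmorphB sd sb sb' sc'.
  - by rewrite fmorph_div rmorphD rmorphM rmorphB sd sb sb' sc' sc.
  apply: (mulfI c'0); rewrite [RHS]mulrC mulfVK //.
  have -> : c = (b' + c' * z - b) * (d + z) by rewrite -e; field.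
  by field.
move=> so sa sk k0 so' sa' sk' k'0 Dw.
case: o o' so so' => [d|] [d'|] //= sd sd' e; last first.
- have [] := lin (k - k') (a' - a) w; rewrite ?rmorphB ?sa ?sk ?sa' ?sk' //.
    apply/eqP; rewrite mulrBl -subr_eq0; apply/eqP.
    by have /eqP := e; rewrite -subr_eq0 => /eqP <-; ring.
  by move=> /subr0_eq -> /subr0_eq ->.
- by case: (dif d' a' a k' k w).
- by case: (dif d a a' k k' w).
have D z : s z = z -> z + w != 0.
  by move=> sz; rewrite -[w]mul1r degree6_neq0 ?degree6_affine ?rmorph1 ?oner_neq0.
have [aa|aa] := eqVneq a a'.
  move: e; rewrite aa => /addrI e.
  have [] := lin (k - k') (k' * d - k * d') w;
    rewrite ?rmorphB ?rmorphM ?sd ?sd' ?sk ?sk' //.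
    have : k / (d + w) * ((d + w) * (d' + w)) -
        k' / (d' + w) * ((d + w) * (d' + w)) = 0.
      by rewrite e subrr.
    have D1 := D _ sd; have D2 := D _ sd'.
    move=> z; apply/eqP; rewrite -subr_eq0; apply/eqP; rewrite -z; field; exact/andP.
  move/subr0_eq => <- /eqP; rewrite -mulrBr mulf_eq0 (negPf k0) /=.
  by rewrite subr_eq0 => /eqP ->.
exfalso; apply: (degree6_quad (d := (d + d') + (k - k') / (a - a'))
    (k := (k' * d - k * d') / (a - a') - d * d') Dw).
- by rewrite !(rmorphB, rmorphD, fmorph_div) sd sd' sk sk' sa sa'.
- by rewrite !(rmorphB, fmorph_div, rmorphM) sd sd' sk sk' sa sa'.
have D1 := D _ sd; have D2 := D _ sd'.
have aa0 : a - a' != 0 by rewrite subr_eq0.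
have z : (a + k / (d + w) - (a' + k' / (d' + w))) * ((d + w) * (d' + w)) / (a - a') = 0.
  by rewrite e subrr !mul0r.
apply/eqP; rewrite -subr_eq0; apply/eqP; rewrite -z; field.
by rewrite D1 D2 aa0.
Qed.

(* If w' = a + k / (d + w), then r below is (d + s w) / (d + w), which
   determines d; r = 1 is the affine case. *)
Lemma conj_ratio_fibre w w' : degree6 w -> degree6 w' -> conj_ratio w = conj_ratio w' ->
  exists o a k, [/\ pole_fixed o, s a = a, s k = k,
    k != 0 & w' = moebius o a k w].
Proof.
move=> Dw Dw' e.
have h := degree6_distinct Dw; have h' := degree6_distinct Dw'.
pose a0 := (w - s w) / (w' - s w'); pose b0 := (w - s (s w)) / (w' - s (s w')).
have w01 : w - s w != 0 := h 0 1 isT isT isT.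
have w02 : w - s (s w) != 0 := h 0 2 isT isT isT.
have w01' : w' - s w' != 0 := h' 0 1 isT isT isT.
have w02' : w' - s (s w') != 0 := h' 0 2 isT isT isT.
have a00 : a0 != 0 by rewrite mulf_neq0 ?invr_eq0.
have b00 : b0 != 0 by rewrite mulf_neq0 ?invr_eq0.
pose r := s a0 / b0.
have r0 : r != 0 by rewrite mulf_neq0 ?invr_eq0 ?fmorph_eq0.
(* Equality of the cross ratios reads b0 * s(b0) = s^2(a0) * a0; dividing by s(b0) gives this
   form. *)
have b0E : b0 = s r * a0.
  rewrite /r fmorph_div; apply: (@mulIf _ (s b0)); first by rewrite fmorph_eq0.
  rewrite [RHS]mulrAC mulfVK ?fmorph_eq0 //.
  rewrite /a0 /b0 !(fmorph_div, rmorphB).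
  have e1 : 1 - conj_ratio w = 1 - conj_ratio w' by rewrite e.
  move: e1; rewrite /conj_ratio /cross_ratio /=.
  have w23 : s (s w) - s (s (s w)) != 0 := h 2 3 isT isT isT.
  have w13' : s w' - s (s (s w')) != 0 := h' 1 3 isT isT isT.
  have w23' : s (s w') - s (s (s w')) != 0 := h' 2 3 isT isT isT.
  move: w01 w02 w01' w02' w23 w13' w23'.
  move: (s w) (s w') (s (s w)) (s (s w')) (s (s (s w))) (s (s (s w'))).
  move=> x1 x1' x2 x2' x3 x3' w01 w02 w01' w02' w23 w13' w23' e1.
  apply/eqP; rewrite -subr_eq0.
  have -> : (w - x2) / (w' - x2') * ((x1 - x3) / (x1' - x3')) -
    (x2 - x3) / (x2' - x3') * ((w - x1) / (w' - x1')) =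
    ((w - x1) * (x2 - x3)) / ((w' - x2') * (x1' - x3')) *
   (1 - (w - x3) * (x2 - x1) / ((w - x1) * (x2 - x3)) -
   (1 - (w' - x3') * (x2' - x1') / ((w' - x1') * (x2' - x3')))).
    by field; repeat (apply/andP; split).
  by rewrite e1 subrr mulr0.
have a1E : s a0 = r * (s r * a0) by rewrite -b0E /r mulfVK.
have w01E : w' - s w' = (w - s w) / a0.
  by rewrite /a0 invfM invrK mulrA mulfV // mul1r.
have w12E : s w' - s (s w') = (s w - s (s w)) / s a0.
  by rewrite -!rmorphB -fmorph_div w01E.
(* The telescoping sum of the differences of w', rewritten through a0 and r; it is what makes d
   below fixed by s. *)
have R : r * s r * (w - s w) + (s w - s (s w)) = r * (w - s (s w)).
  have w02E : w' - s (s w') = (w - s (s w)) / b0.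
    by rewrite /b0 invfM invrK mulrA mulfV // mul1r.
  have : w' - s w' + (s w' - s (s w')) = w' - s (s w') by ring.
  rewrite w02E w01E w12E a1E b0E.
  have : s r != 0 by rewrite fmorph_eq0.
  move=> sr0 z; apply/eqP; rewrite -subr_eq0.
  rewrite (_ : _ - _ = (r * s r * a0) * ((w - s w) / a0 +
    (s w - s (s w)) / (r * (s r * a0)) - (w - s (s w)) / (s r * a0))).
    by rewrite z subrr mulr0.
  by field; rewrite ?a00 ?r0 ?sr0.
clearbody r b0 a0.
have [r1|r1] := eqVneq r 1.
  have sa0 : s a0 = a0 by rewrite a1E r1 rmorph1 !mul1r.
  exists None, (w' - a0^-1 * w), a0^-1; split=> //.
  - rewrite rmorphB rmorphM fmorphV sa0; apply/eqP; rewrite -subr_eq0; apply/eqP.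
    transitivity ((w - s w) / a0 - (w' - s w')); last by rewrite w01E subrr.
    by ring.
  - by rewrite fmorphV sa0.
  - by rewrite invr_eq0.
  - by rewrite /moebius subrK.
have r1' : 1 - r != 0 by rewrite subr_eq0 eq_sym.
have sr1 : 1 - s r != 0 by rewrite -(rmorph1 s) -rmorphB fmorph_eq0.
pose d := (r * w - s w) / (1 - r).
have sd : s d = d.
  rewrite /d fmorph_div !rmorphB rmorphM rmorph1; apply/eqP.
  rewrite eqr_div // -subr_eq0; apply/eqP.
  transitivity (r * s r * (w - s w) + (s w - s (s w)) - r * (w - s (s w))).
    by ring.
  by rewrite R subrr.
have De : degree6 (d + w) by rewrite -[w]mul1r degree6_affine ?rmorph1 ?oner_neq0.
have E0 := degree6_neq0 De.
have sE : s (d + w) = r * (d + w) by rewrite rmorphD sd /d; field.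
(* For w' = a + k / E with E = d + w one has a0 = - E * s(E) / k and s(E) = r * E, which forces this
   k. *)
pose k := - (r * (d + w) * (d + w)) / a0.
have sk : s k = k.
  rewrite /k fmorph_div rmorphN !rmorphM sE a1E.
  have sr0 : s r != 0 by rewrite fmorph_eq0.
  by field; rewrite ?a00 ?r0 ?sr0.
have k0 : k != 0 by rewrite mulf_neq0 ?invr_eq0 // oppr_eq0 !mulf_neq0.
exists (Some d), (w' - k / (d + w)), k; split=> //; last by rewrite /moebius subrK.
rewrite rmorphB fmorph_div sk sE; apply/eqP; rewrite -subr_eq0; apply/eqP.
transitivity ((w - s w) / a0 - (w' - s w')); last by rewrite w01E subrr.
have -> : w - s w = (1 - r) * (d + w) by rewrite mulrBl mul1r -sE rmorphD sd; ring.
move: E0; rewrite /k; move: (d + w) => E E0; field.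
by rewrite ?a00 ?r0 ?E0.
Qed.

(* The right-hand side is the vanishing of the determinant with rows
   (1, s^i t, s^i n), i = 0, 1, 2. *)
Lemma conj_ratio_fixed3 w (t := w + iter 3 s w) (n := w * iter 3 s w) : degree6 w ->
  (iter 3 s (conj_ratio w) == conj_ratio w) =
  ((s t - t) * (s (s n) - n) == (s n - n) * (s (s t) - t)).
Proof.
move/degree6_distinct => h.
have h03 := h 0 3 isT isT isT; have h01 := h 0 1 isT isT isT.
have h23 := h 2 3 isT isT isT; have h34 := h 3 4 isT isT isT.
have h50 := h 5 0 isT isT isT.
have E : iter 3 s (conj_ratio w) - conj_ratio w = (w - iter 3 s w) /
  ((w - iter 1 s w) * (iter 2 s w - iter 3 s w) *
   (iter 3 s w - iter 4 s w) * (iter 5 s w - w)) *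
   ((s t - t) * (s (s n) - n) - (s n - n) * (s (s t) - t)).
  rewrite /t /n /= !rmorph_conj_ratio /conj_ratio /= !(rmorphD, rmorphM) !s6E.
  move: h01 h23 h34 h50 => /=; move: (s w) (s (s w)) (s (s (s w))).
  move=> w1 w2 w3; move: (s w3) (s (s w3)) => w4 w5 h01 h23 h34 h50.
  rewrite /cross_ratio; field.
  by rewrite h01 h23 h34 h50.
rewrite -subr_eq0 E mulf_eq0 subr_eq0 mulf_eq0 invr_eq0 !mulf_eq0.
by rewrite (negPf h03) (negPf h01) (negPf h23) (negPf h34) (negPf h50).
Qed.

(** Expanding, the norm of w - a is n - a t + a^2, and s fixes a^2. *)
Lemma fixed_norm_sub w a (t := w + iter 3 s w) (n := w * iter 3 s w) : s a = a ->
  s ((w - a) * iter 3 s (w - a)) = (w - a) * iter 3 s (w - a) <->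
  s n - n = a * (s t - t).
Proof.
move=> sa; suff -> : s n - n = a * (s t - t) + (s ((w - a) * iter 3 s (w - a)) -
    (w - a) * iter 3 s (w - a)).
  split=> [->|/eqP]; first by rewrite subrr addr0.
  by rewrite -subr_eq0 addrC addKr subr_eq0 => /eqP.
by rewrite /n /t /= !(rmorphB, rmorphD, rmorphM) !sa; ring.
Qed.

(** The determinant vanishes when 1, t, n are dependent over the fixed field of s. If t is not
    fixed, then n - a t is fixed for some fixed a, and translating w by a makes its norm fixed. *)
Lemma conj_ratio_fixed3P w (t := w + iter 3 s w) : degree6 w ->
  iter 3 s (conj_ratio w) = conj_ratio w <->
  s t = t \/ (exists2 a, s a = a & s ((w - a) * iter 3 s (w - a)) =
                                   (w - a) * iter 3 s (w - a)).
Proof.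
move=> Dw; have := conj_ratio_fixed3 Dw; rewrite -/t; set n := w * _ => fE.
split=> [/eqP|H].
  rewrite fE => /eqP e.
  have [|st] := eqVneq (s t) t; [by left | right].
  have st0 : s t - t != 0 by rewrite subr_eq0.
  have sst0 : s (s t) - s t != 0 by rewrite -rmorphB fmorph_eq0.
  have sa : s ((s n - n) / (s t - t)) = (s n - n) / (s t - t).
    rewrite fmorph_div [s (s n - n)]rmorphB [s (s t - t)]rmorphB; apply/eqP.
    rewrite eqr_div //; apply/eqP/subr0_eq.
    transitivity ((s t - t) * (s (s n) - n) - (s n - n) * (s (s t) - t)).
      by ring.
    by rewrite e subrr.
  exists ((s n - n) / (s t - t)) => //.
  by apply/fixed_norm_sub; rewrite // -/n -/t mulfVK.
apply/eqP; rewrite fE; apply/eqP.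
case: H => [st | [a sa]]; first by rewrite !st !subrr mul0r mulr0.
move/(fixed_norm_sub w sa); rewrite -/n -/t => nn.
have nn2 : s (s n) - n = a * (s (s t) - t).
  have -> : s (s n) - n = s (s n - n) + (s n - n) by rewrite [s (_ - _)]rmorphB; ring.
  by rewrite nn rmorphM [s (s t - t)]rmorphB sa; ring.
by rewrite nn nn2; ring.
Qed.

(** The relation s(n) - n = a (s(t) - t) determines a unless t is fixed; in that case n is fixed
    too, and w is a root of X^2 - t X + n. *)
Lemma fixed_norm_sub_uniq w a a' : degree6 w -> s a = a -> s a' = a' ->
   s ((w - a) * iter 3 s (w - a)) = (w - a) * iter 3 s (w - a) ->
   s (w + iter 3 s w) != w + iter 3 s w /\
   (s ((w - a') * iter 3 s (w - a')) = (w - a') * iter 3 s (w - a') -> a = a').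
Proof.
move=> Dw sa sa' /(fixed_norm_sub w sa); set t := w + _ => e.
have st : s t != t.
  apply/eqP => st.
  apply: (degree6_quad (d := - t) (k := - (w * iter 3 s w)) Dw); last first.
  - by rewrite /t; ring.
  - by rewrite rmorphN; congr (- _); apply/eqP; rewrite -subr_eq0 e st subrr mulr0.
  - by rewrite rmorphN st.
split=> // /(fixed_norm_sub w sa'); rewrite -/t => e'.
by apply: (@mulIf _ (s t - t)); rewrite ?subr_eq0 // -e.
Qed.

End FrobeniusConjugates.

(** * Counting finite sets through the fibres of a map *)

Section Fibres.
Variables (T U : finType) (f : T -> U).

Lemma card_fibres (A : {set T}) (B : {set U}) :
  {in A, forall x, f x \in B} ->
  #|A| = (\sum_(y in B) #|[set x in A | f x == y]|)%N.
Proof.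
move=> AB; rewrite -sum1_card (partition_big f [in B]) //=; apply: eq_bigr => y _.
by rewrite -sum1_card; apply: eq_bigl => x; rewrite inE.
Qed.

Lemma card_fibres_le (A : {set T}) (B : {set U}) n :
  {in A, forall x, f x \in B} ->
  {in B, forall y, #|[set x in A | f x == y]| <= n}%N ->
  (#|A| <= #|B| * n)%N.
Proof.
move=> AB le; rewrite (card_fibres AB) -sum_nat_const.
exact: leq_sum.
Qed.

(** The fibre sizes sum to the largest value their bounds allow, so each bound is attained. *)
Lemma card_fibres_eq (A : {set T}) (B : {set U}) n :
  {in A, forall x, f x \in B} ->
  {in B, forall y, #|[set x in A | f x == y]| <= n}%N ->
  #|A| = (#|B| * n)%N -> {in B, forall y, #|[set x in A | f x == y]| = n}.
Proof.
move=> AB le; rewrite (card_fibres AB) -sum_nat_const => /eqP.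
have := leqif_sum (fun y By =>
  conj (le y By) (erefl (#|[set x in A | f x == y]| == n))).
by case=> _ -> /forall_inP e y /e /eqP.
Qed.

Lemma card_uniform_fibres (A : {set T}) n :
  {in A, forall x, #|[set y in A | f y == f x]| = n} ->
  #|A| = (#|f @: A| * n)%N.
Proof.
move=> e; rewrite (@card_fibres _ (f @: A)); last by move=> x; apply: imset_f.
by rewrite -sum_nat_const; apply: eq_bigr => y /imsetP[x Ax ->]; exact: e.
Qed.

(** Each fibre is {x, i x}; counting the fixed points of i once more gives every fibre weight 2. *)
Lemma card_involution_fibres (A : {set T}) (i : T -> T) :
  {in A, forall x, i x \in A} ->
  {in A &, forall x y, f x = f y <-> y = x \/ y = i x} ->
  (2 * #|f @: A| = #|A| + #|[set x in A | i x == x]|)%N.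
Proof.
move=> iA fi.
rewrite (@card_fibres A (f @: A)); last by move=> x; apply: imset_f.
rewrite (@card_fibres [set x in A | i x == x] (f @: A)); last first.
  by move=> x; rewrite inE => /andP[Ax _]; apply: imset_f.
rewrite -big_split mulnC -sum_nat_const; apply: eq_bigr => _ /imsetP[x Ax ->] /=.
have -> : [set y in A | f y == f x] = [set x; i x].
  apply/setP=> y; rewrite !inE; apply/andP/orP => [[Ay /eqP/esym /fi]|].
    by move=> /(_ Ax Ay) [] ->; rewrite eqxx; [left|right].
  have fix_ : f (i x) = f x by apply/esym/fi; rewrite ?iA //; right.
  by case=> /eqP ->; rewrite ?iA ?fix_.
have -> : [set y in [set x0 in A | i x0 == x0] | f y == f x] =
  if i x == x then [set x] else set0.
  apply/setP=> y; rewrite !inE; apply/idP/idP => [/andP[/andP[Ay iy] /eqP /fi]|].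
    move=> /(_ Ay Ax) e; have -> : x = y by case: e; rewrite ?(eqP iy).
    by rewrite iy inE.
  by case: ifP => ix; rewrite ?inE // => /eqP ->; rewrite Ax ix eqxx.
by rewrite cards2 eq_sym; case: eqP; rewrite ?cards1 ?cards0.
Qed.

End Fibres.

(** * Subfields of F_{q^6} and elements of degree 6 *)

Section FiniteField.
Local Open Scope ring_scope.

Lemma card_roots_le (L : finFieldType) (p : {poly L}) (A : {set L}) n :
  p != 0 -> (size p <= n.+1)%N -> {in A, forall x, root p x} -> (#|A| <= n)%N.
Proof.
move=> p0 sp rA; rewrite cardE -ltnS; apply: leq_trans sp.
apply: max_poly_roots; rewrite ?enum_uniq //.
by apply/allP => x; rewrite mem_enum => /rA.
Qed.

Variables (L : finFieldType) (q : nat) (s : {rmorphism L -> L}).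
Hypothesis sE : forall x, s x = x ^+ q.
Hypothesis cardL : #|L| = (q ^ 6)%N.
Implicit Types (w x y a k d b : L).

Lemma q_gt1 : (1 < q)%N.
Proof.
by have := finNzRing_gt1 L; rewrite cardL; case: q => [|[|?]].
Qed.
Let q1 := q_gt1.

Lemma iter_sE i x : iter i s x = x ^+ (q ^ i).
Proof.
elim: i => [|i IH] /=; first by rewrite expn0 expr1.
by rewrite IH sE -exprM expnSr.
Qed.

Lemma s_order6 x : iter 6 s x = x.
Proof. by rewrite iter_sE -cardL expf_card. Qed.
Let s6 := s_order6.
Let s6E x : s (s (s (s (s (s x))))) = x. Proof. exact: s6. Qed.

(* Both claims follow at once from bounding the fibres of x |-> x^m on the
   q^6 - 1 nonzero elements by m and its image by n. *)
Lemma unity_roots m n : (m * n)%N = (q ^ 6).-1 ->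
  #|[set x : L | x ^+ n == 1]| = n /\
  (forall y, y ^+ n = 1 -> exists x, x ^+ m = y).
Proof.
move=> mn.
have mn0 : (0 < m * n)%N by rewrite mn -subn1 subn_gt0 -(exp1n 6) ltn_exp2r.
have [m0 n0] : (0 < m)%N /\ (0 < n)%N by apply/andP; rewrite -muln_gt0.
pose A := [set x : L | x != 0]; pose B := [set y : L | y ^+ n == 1].
have cA : #|A| = (n * m)%N.
  have -> : A = [set: L] :\ 0 by apply/setP=> x; rewrite !inE andbT.
  by rewrite cardsDS ?sub1set ?inE // cards1 cardsT cardL subn1 mulnC.
have AB : {in A, forall x, x ^+ m \in B}.
  move=> x; rewrite !inE -exprM mn -cardL => x0; apply/eqP/(mulfI x0).
  by rewrite -exprS prednK ?expf_card ?mulr1 // ltnW ?finNzRing_gt1.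
have cB : (#|B| <= n)%N.
  apply: (@card_roots_le _ ('X^n - 1)); rewrite ?size_XnsubC //.
    by rewrite -size_poly_eq0 size_XnsubC.
  by move=> x; rewrite inE rootE !hornerE => /eqP ->; rewrite subrr.
have fib : {in B, forall y, #|[set x in A | x ^+ m == y]| <= m}%N.
  move=> y _; apply: (@card_roots_le _ ('X^m - y%:P)); rewrite ?size_XnsubC //.
    by rewrite -size_poly_eq0 size_XnsubC.
  by move=> x; rewrite !inE rootE !hornerE => /andP[_ /eqP ->]; rewrite subrr.
have cBn : #|B| = n.
  apply/eqP; rewrite eqn_leq cB -(leq_pmul2r m0) -cA.
  exact: card_fibres_le AB fib.
split=> // y By; have := card_fibres_eq AB fib; rewrite cA cBn => /(_ erefl y).
rewrite inE By eqxx => /(_ isT) cy.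
have /card_gt0P[x] : (0 < #|[set x in A | x ^+ m == y]|)%N by rewrite cy.
by rewrite inE => /andP[_ /eqP <-]; exists x.
Qed.

Definition fixed i := [set x : L | iter i s x == x].

(** The nonzero elements fixed by s^i are the roots of X^(q^i - 1) - 1, which all lie in L because
    q^i - 1 divides q^6 - 1. *)
Lemma card_fixed i : i \in [:: 1; 2; 3] -> #|fixed i| = (q ^ i)%N.
Proof.
move=> i123; pose m := (\sum_(j < 6 %/ i) (q ^ i) ^ j)%N.
have qi0 : (0 < q ^ i)%N by rewrite expn_gt0 ltnW.
have /unity_roots[cr _] : (m * (q ^ i).-1)%N = (q ^ 6).-1.
  rewrite mulnC -predn_exp -expnM mulnC divnK //.
  by move: i123; rewrite !inE => /or3P[] /eqP->.
have -> : fixed i = 0 |: [set x : L | x ^+ (q ^ i).-1 == 1].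
  apply/setP=> x; rewrite !inE iter_sE; have [->|x0] /= := eqVneq x 0.
    by rewrite expr0n eqn0Ngt qi0 /= eqxx.
  have -> : x ^+ (q ^ i) = x * x ^+ (q ^ i).-1 by rewrite -exprS prednK.
  by rewrite -[X in _ == X]mulr1 (inj_eq (mulfI x0)).
have qi1 : (1 < q ^ i)%N.
  by rewrite -(exp1n i) ltn_exp2r //; move: i123; rewrite !inE => /or3P[] /eqP->.
rewrite cardsU1 cr inE expr0n.
have -> : ((q ^ i).-1 == 0)%N = false by lia.
by rewrite eq_sym oner_eq0 /=; lia.
Qed.

Lemma fixed_rmorph i x : (x \in fixed i) = (iter i s x == x).
Proof. by rewrite inE. Qed.

Lemma fixed1_sub i x : x \in fixed 1 -> x \in fixed i.
Proof. by rewrite !inE => /eqP /= e; elim: i => //= i /eqP ->; rewrite e. Qed.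

Definition deg6 := [set w : L | degree6 s w].

Lemma deg6E : deg6 = ~: (fixed 3 :|: fixed 2).
Proof. by apply/setP=> x; rewrite !inE negb_or. Qed.

Lemma fixed32 : fixed 3 :&: fixed 2 = fixed 1.
Proof.
apply/setP=> x; rewrite !inE; apply/andP/eqP => /= [[/eqP e3 /eqP e2]|e].
  by rewrite -{2}e3 e2.
by rewrite !e.
Qed.

Lemma card_fixed32 : (#|fixed 3 :|: fixed 2| + q = q ^ 3 + q ^ 2)%N.
Proof.
have := cardsUI (fixed 3) (fixed 2); rewrite fixed32 !card_fixed //.
Qed.

Lemma card_deg6 : (#|deg6| + q ^ 3 + q ^ 2 = q ^ 6 + q)%N.
Proof.
have := cardsC (fixed 3 :|: fixed 2); rewrite -deg6E cardL.
have := card_fixed32; lia.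
Qed.

(** * The values of c, with fibres the orbits of PGL(2,q) *)

Local Notation pole_fixed o := (if o is Some d then s d = d else True).

(** Normal forms of the elements of PGL(2,q): q + 1 choices of o, q of a and q - 1 of k. *)
Definition moebius_params : {set option L * L * L} :=
  setX (setX (None |: Some @: fixed 1) (fixed 1)) (fixed 1 :\ 0).

Lemma mem_moebius_params o a k : ((o, a, k) \in moebius_params) ->
  [/\ pole_fixed o, s a = a, s k = k & k != 0].
Proof.
rewrite !inE /= => /andP[/andP[/orP[] o1 /eqP sa] /andP[k0 /eqP sk]].
  by split=> //; case: o o1.
by split=> //; case/imsetP: o1 => d /[!inE] /eqP sd ->.
Qed.

Lemma card_moebius_params : (#|moebius_params| + q = q ^ 3)%N.
Proof.
have q0 : 0 \in fixed 1 by rewrite inE /= rmorph0.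
rewrite !cardsX cardsU1 card_imset; last by move=> x y [].
rewrite card_fixed // cardsDS ?sub1set // cards1 card_fixed // expn1.
have -> : (None \in [set Some x | x in fixed 1]) = false.
  by apply/imsetP => -[].
have [r ->] : exists r, q = r.+1 by exists q.-1; lia.
by rewrite subn1 /=; ring.
Qed.

Lemma card_conj_ratio_fibre w : w \in deg6 ->
  #|[set w' in deg6 | conj_ratio s w' == conj_ratio s w]| = #|moebius_params|.
Proof.
rewrite inE => Dw.
have <- : (fun p => moebius p.1.1 p.1.2 p.2 w) @: moebius_params =
   [set w' in deg6 | conj_ratio s w' == conj_ratio s w].
  apply/setP=> w'; apply/imsetP/idP.
    case=> -[[o a] k] /mem_moebius_params[so sa sk k0] ->.
    rewrite !inE /= (degree6_moebius w so sa sk k0) Dw.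
    by rewrite (conj_ratio_moebius s6 so sa sk k0 Dw) eqxx.
  rewrite !inE => /andP[Dw' /eqP/esym e].
  have [o [a [k [so sa sk k0 ->]]]] := conj_ratio_fibre s6 Dw Dw' e.
  exists (o, a, k) => //; rewrite !inE /= sa sk k0 !eqxx !andbT.
  by case: o so => [d|] sd //=; rewrite imset_f ?inE /= ?sd.
apply: card_in_imset => -[[o a] k] [[o' a'] k'] /mem_moebius_params[so sa sk k0].
move=> /mem_moebius_params[so' sa' sk' k'0] /= e.
by have [-> -> ->] := moebius_inj so sa sk k0 so' sa' sk' k'0 Dw e.
Qed.

(** All fibres have q^3 - q elements, and q^6 - q^3 - q^2 + q = (q^3 - q)(q^3 + q - 1). *)
Lemma card_conj_ratio_img : #|conj_ratio s @: deg6| = (q ^ 3 + q - 1)%N.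
Proof.
have := card_uniform_fibres card_conj_ratio_fibre.
have := card_deg6; have := card_moebius_params.
move: #|deg6| #|moebius_params| #|conj_ratio s @: deg6| => d m z; move: (q) q_gt1.
move=> r r1 e1 e2 e3.
have r3 : (r < r ^ 3)%N by rewrite -{1}(expn1 r) ltn_exp2l.
have {e1} e1 : m = (r ^ 3 - r)%N by lia.
apply/eqP; rewrite -(@eqn_pmul2r (r ^ 3 - r)%N) ?subn_gt0 //; apply/eqP.
rewrite e1 in e3; rewrite -e3; apply: (@addIn (r ^ 3 + r ^ 2)%N); rewrite addnA e2.
have [u ->] : exists u, r = u.+1 by exists r.-1; lia.
nia.
Qed.

(** * The w with c(w) in K, counted by trace and norm to K *)

Lemma card_trace_fixed :
  #|[set w : L | s (w + iter 3 s w) == w + iter 3 s w]| = (q ^ 4)%N.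
Proof.
pose tr w := w + iter 3 s w.
have trK : {in [set: L], forall x, tr x \in fixed 3}.
  by move=> x _; rewrite inE /tr /= !rmorphD [s (s (s (s (s (s x)))))]s6 addrC.
have q3 : (1 < q ^ 3)%N by rewrite -(exp1n 3) ltn_exp2r.
have le : {in fixed 3, forall y, #|[set x in [set: L] | tr x == y]| <= q ^ 3}%N.
  move=> y _; apply: (@card_roots_le _ ('X^(q ^ 3) + ('X - y%:P))).
  - by rewrite -size_poly_eq0 size_polyDl ?size_polyXn // size_XsubC ltnS.
  - by rewrite size_polyDl ?size_polyXn // size_XsubC ltnS.
  - move=> x; rewrite !inE /tr rootE !hornerE -iter_sE /= => /eqP <-.
    by apply/eqP; ring.
(* The trace has at most q^3 values with at most q^3 preimages each, so q^6 elements force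
   equality. *)
have eq := card_fibres_eq trK le.
rewrite (@card_fibres _ _ tr _ (fixed 1)); last by move=> x; rewrite !inE.
rewrite (eq_bigr (fun=> (q ^ 3)%N)) => [|y y1].
  by rewrite sum_nat_const card_fixed // -expnD.
have <- : #|[set x in [set: L] | tr x == y]| = (q ^ 3)%N.
  apply: eq; last exact: fixed1_sub.
  by rewrite cardsT cardL card_fixed // -expnD.
apply: eq_card => x; rewrite !inE /= -/(tr x); rewrite inE /= in y1.
by case: (eqVneq (tr x) y) => [->|]; rewrite ?y1 ?andbF.
Qed.

(** A nonzero w has norm in F_q when w^((q^3 + 1)(q - 1)) = 1, and this exponent divides q^6 - 1
    with cofactor q^2 + q + 1. *)
Lemma card_norm_fixed : #|[set w : L | s (w * iter 3 s w) == w * iter 3 s w]| =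
  ((q ^ 3 + 1) * (q - 1) + 1)%N.
Proof.
pose n := ((q ^ 3).+1 * q.-1)%N.
have n0 : (0 < n)%N by rewrite /n muln_gt0 /=; lia.
have mn : ((q ^ 2 + q + 1) * n)%N = (q ^ 6).-1.
  rewrite /n.
  have [u ->] : exists u, q = u.+1 by exists q.-1; lia.
  rewrite /= ; nia.
have [cr _] := unity_roots mn.
have -> : [set w : L | s (w * iter 3 s w) == w * iter 3 s w] =
  0 |: [set x | x ^+ n == 1].
  apply/setP=> x; rewrite !inE iter_sE sE; have [->|x0] /= := eqVneq x 0.
    by rewrite mul0r expr0n; apply/eqP; case: q q1.
  have y0 : x * x ^+ (q ^ 3) != 0 by rewrite mulf_neq0 ?expf_neq0.
  rewrite /n exprM exprS; move: (x * _) y0 => y y0.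
  have -> : y ^+ q = y * y ^+ q.-1 by rewrite -exprS prednK // ltnW.
  by rewrite -[X in _ == X]mulr1 (inj_eq (mulfI y0)).
rewrite cardsU1 cr inE expr0n (negPf (lt0n_neq0 n0)) eq_sym oner_eq0 /=.
by rewrite add1n !addn1 subn1.
Qed.

(** An x in K has norm x^2, and s(x^2) = x^2 means s(x) = x or s(x) = - x, so x lies in F_{q^2}. On
    F_{q^2} the norm is x * s(x), which s fixes. *)
Lemma fixed_norm32 :
  [set w : L | s (w * iter 3 s w) == w * iter 3 s w] :&: (fixed 3 :|: fixed 2) =
  fixed 2.
Proof.
apply/setP=> x; rewrite !inE /=; apply/idP/idP => [/andP[e /orP[]//]|/eqP e].
  move=> /eqP e3; move: e; rewrite e3 rmorphM -subr_eq0 -!expr2 subr_sqr mulf_eq0.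
  case/orP => [|e]; first by rewrite subr_eq0 => /eqP e; rewrite !e.
  have sx : s x = - x by apply/eqP; rewrite -subr_eq0 opprK.
  by rewrite sx rmorphN sx opprK.
by rewrite !e rmorphM e mulrC !eqxx orbT.
Qed.

Let trace_fixed := [set w : L | s (w + iter 3 s w) == w + iter 3 s w].
Let norm_fixed := [set w : L | s (w * iter 3 s w) == w * iter 3 s w].

Lemma card_deg6_norm_fixed :
  (#|deg6 :&: norm_fixed| + q ^ 2 = (q ^ 3 + 1) * (q - 1) + 1)%N.
Proof.
rewrite -card_norm_fixed -(cardsID (fixed 3 :|: fixed 2) norm_fixed).
by rewrite fixed_norm32 card_fixed // addnC setDE -deg6E setIC.
Qed.

(** On F_{q^2} the trace w + s(w) is always fixed by s; on K it is 2 w, always fixed in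
    characteristic 2 and otherwise only for w in F_q. The term q^3 - q counts K outside F_q. *)
Lemma card_deg6_trace_fixed :
  (#|deg6 :&: trace_fixed| + q ^ 2 + (2 == 0 :> L)%R * (q ^ 3 - q) = q ^ 4)%N.
Proof.
rewrite -card_trace_fixed -(cardsID (fixed 3 :|: fixed 2) trace_fixed).
rewrite [in RHS]addnC setDE -deg6E setIC -addnA; congr addn.
have F2 x : x \in fixed 2 -> x \in trace_fixed.
  rewrite !inE /= => /eqP e.
  by rewrite e rmorphD e addrC.
have [c|c] := eqVneq (2 : L) 0.
  have -> : trace_fixed :&: (fixed 3 :|: fixed 2) = fixed 3 :|: fixed 2.
    apply/setIidPr/subsetP => x; rewrite inE => /orP[|/F2 //].
    rewrite !inE /= => /eqP ->; rewrite -mulr2n -mulr_natl c mul0r.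
    by rewrite rmorph0.
  have := card_fixed32; have := leq_pexp2l (ltnW q1) (isT : 1 <= 3)%N.
  rewrite expn1; lia.
have -> : trace_fixed :&: (fixed 3 :|: fixed 2) = fixed 2.
  apply/setP => x; rewrite !inE -!fixed_rmorph.
  apply/andP/idP => [[]|x2]; last by have := F2 _ x2; rewrite x2 orbT inE.
  move=> + /orP[|//]; rewrite !fixed_rmorph /= => + /eqP e; rewrite e.
  rewrite -mulr2n -mulr_natl rmorphM rmorph_nat (inj_eq (mulfI c)) => /eqP sx.
  by rewrite !sx.
by rewrite card_fixed // addn0.
Qed.

Lemma fixed_conj_ratioE :
  [set w in deg6 | iter 3 s (conj_ratio s w) == conj_ratio s w] =
  (deg6 :&: trace_fixed) :|:
    (fun p => p.1 + p.2) @: setX (fixed 1) (deg6 :&: norm_fixed).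
Proof.
have trans a w : s a = a -> degree6 s (a + w) = degree6 s w.
  by move=> sa; rewrite -[w in LHS]mul1r degree6_affine ?rmorph1 ?oner_neq0.
apply/setP=> w; rewrite !inE; apply/andP/orP => [[Dw /eqP]|].
  case/(conj_ratio_fixed3P s6 Dw) => [tw | [a sa nw]].
    by left; rewrite Dw tw eqxx.
  right; apply/imsetP; exists (a, w - a); rewrite /= ?subrKC //.
  rewrite !inE /= sa nw !eqxx andbT /=.
  by rewrite -(trans a) // subrKC.
case=> [/andP[Dw /eqP tw]|].
  by split=> //; apply/eqP/(conj_ratio_fixed3P s6) => //; left.
case/imsetP=> -[a v] /[!inE] /= /andP[/eqP sa /andP[Dv /eqP nv]] ->.
have Dw : degree6 s (a + v) by rewrite trans.
split=> //; apply/eqP/(conj_ratio_fixed3P s6) => //; right.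
by exists a => //; rewrite addrC addKr.
Qed.

(** By [fixed_norm_sub_uniq] the union is disjoint and the sums a + v do not repeat: traces
    contribute q^4 - q^2, less q^3 - q in characteristic 2, and norms q (q^4 - q^3 - q^2 + q). *)
Lemma card_conj_ratio_fixed :
  #|[set w in deg6 | iter 3 s (conj_ratio s w) == conj_ratio s w]| =
  ((q ^ 2 - (2 == 0 :> L)%R) * (q ^ 3 - q))%N.
Proof.
have trans a w : s a = a -> degree6 s (a + w) = degree6 s w.
  by move=> sa; rewrite -[w in LHS]mul1r degree6_affine ?rmorph1 ?oner_neq0.
rewrite fixed_conj_ratioE; set B := _ @: _.
have dis : (deg6 :&: trace_fixed) :&: B = set0.
  apply/setP=> w; rewrite !inE; apply/negP => /andP[/andP[Dw tw]].
  case/imsetP=> -[a v] /[!inE] /= /andP[/eqP sa /andP[Dv /eqP nv]] e.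
  have : s ((w - a) * iter 3 s (w - a)) = (w - a) * iter 3 s (w - a).
    by rewrite e addrC addKr.
  by move/(fixed_norm_sub_uniq Dw sa sa) => [/negP[]].
have cB : #|B| = (q * #|deg6 :&: norm_fixed|)%N.
  rewrite card_in_imset ?cardsX ?card_fixed //.
  move=> [a v] [a' v'] /[!inE] /= /andP[/eqP sa /andP[Dv /eqP nv]].
  move=> /andP[/eqP sa' /andP[Dv' /eqP nv']] e.
  have Dw : degree6 s (a + v) by rewrite trans.
  have na : s ((a + v - a) * iter 3 s (a + v - a)) =
      (a + v - a) * iter 3 s (a + v - a).
    by rewrite addrC addKr.
  have na' : s ((a + v - a') * iter 3 s (a + v - a')) =
      (a + v - a') * iter 3 s (a + v - a').
    by rewrite e addrC addKr.
  have [_ /(_ na') aa] := fixed_norm_sub_uniq Dw sa sa' na.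
  by move: e; rewrite aa => /addrI ->.
rewrite cardsU dis cards0 subn0 cB.
have := card_deg6_norm_fixed; have := card_deg6_trace_fixed.
move: #|_| #|_| q1 => t n r1.
have [r rE] : exists r, q = r.+2 by exists q.-2; lia.
rewrite rE => {rE r1}.
have -> : (r.+2 ^ 3 - r.+2)%N = (r.+2 * r.+1 * r.+3)%N.
  rewrite -[X in (_ - X)%N]muln1 expnS -mulnBr -mulnA; congr muln.
  by rewrite -(exp1n 2) subn_sqr subn1 addn1 mulnC.
case: (_ == _); rewrite ?mul1n ?mul0n ?addn0 ?subn0 !subn1 /=; nia.
Qed.

(** * The number of values of X and of the norms left over *)

Definition norm_of_conj_ratio t := 1 - t * s t.

(** X = 1 - c s(c) identifies exactly c and s^3(c), so twice the number of values of X is q^3 + q -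
    1 plus the number of values c in K. *)
Lemma card_norm_ratio_img :
  (2 * #|norm_ratio s @: deg6| + 1 + (2 == 0 :> L)%R = q ^ 3 + q ^ 2 + q)%N.
Proof.
have -> : norm_ratio s @: deg6 = norm_of_conj_ratio @: (conj_ratio s @: deg6).
  by rewrite -imset_comp; apply: eq_in_imset => w /[!inE] /(norm_ratioE s6).
have D3 w : degree6 s w -> degree6 s (iter 3 s w).
  by rewrite /degree6 -!iterD /= !(inj_eq (fmorph_inj s)).
have crN3 w : norm_ratio s (iter 3 s w) = norm_ratio s w.
  by rewrite -[RHS](norm_ratio_fixed3 s6) /= !rmorph_norm_ratio.
have cr3 w : iter 3 s (conj_ratio s w) = conj_ratio s (iter 3 s w).
  by rewrite /= !rmorph_conj_ratio.
pose P := [set w in deg6 | iter 3 s (conj_ratio s w) == conj_ratio s w].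
rewrite (@card_involution_fibres _ _ _ _ (iter 3 s)).
- have -> : [set x in conj_ratio s @: deg6 | iter 3 s x == x] = conj_ratio s @: P.
    apply/setP=> t; rewrite inE; apply/andP/imsetP => [[/imsetP[w Dw ->] e]|[w]].
      by exists w; rewrite // inE Dw.
    by rewrite inE => /andP[Dw e] ->; rewrite imset_f.
  have cm : (q ^ 3 - q)%N = #|moebius_params|.
    by have := card_moebius_params; lia.
  have fibP : {in P, forall w,
      #|[set y in P | conj_ratio s y == conj_ratio s w]| = (q ^ 3 - q)%N}.
    move=> w /[!inE] /andP[Dw e].
    rewrite cm -(card_conj_ratio_fibre (w := w)) ?inE //.
    apply: eq_card => y; rewrite !inE.
    by case: (eqVneq (conj_ratio s y)) => [->|]; rewrite ?andbF // e andbT.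
  have q3 : (q < q ^ 3)%N by rewrite -{1}(expn1 q) ltn_exp2l.
  have := card_uniform_fibres fibP; rewrite card_conj_ratio_fixed.
  move/eqP; rewrite eqn_pmul2r ?subn_gt0 // => /eqP <-.
  have q2 : (1 < q ^ 2)%N by rewrite -(exp1n 2) ltn_exp2r.
  by rewrite card_conj_ratio_img; case: (_ == _); lia.
- by move=> _ /imsetP[w Dw ->]; rewrite cr3 imset_f // inE D3 //; rewrite inE in Dw.
move=> _ _ /imsetP[w + ->] /imsetP[w' + ->]; rewrite !inE => Dw Dw'.
rewrite /norm_of_conj_ratio -!(norm_ratioE s6) //.
split; first exact: conj_ratio_of_norm_ratio.
rewrite cr3 => -[] e; rewrite !(norm_ratioE s6) // e -?(norm_ratioE s6) ?crN3 //.
exact: D3.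
Qed.

(** The norms of those b for which U_b is scattered, as [max_scatteredE] shows. *)
Definition scattered_norms :=
  [set n in fixed 3 | [&& n != 0, n != 1 & n \notin norm_ratio s @: deg6]].

Lemma char2_even : (2 == 0 :> L) = ~~ odd q.
Proof.
have [p p_pr pL] := finPcharP L.
have e : odd (p ^ logn p #|L|) = odd q.
  by rewrite -(card_pprimeChar pL) cardL oddX.
rewrite -(dvdn_pcharf pL) -e oddX.
have -> : (logn p #|L| == 0)%N = false.
  apply/negP => /eqP z; move: (card_pprimeChar pL); rewrite z expn0 => L1.
  by have := finNzRing_gt1 L; rewrite L1.
rewrite dvdn_prime2 //=.
by case: (even_prime p_pr) => [->//|op]; rewrite op; apply/eqP => p2; rewrite p2 in op.
Qed.

(** The count is q^3 - 2 minus the number of values of X. The product (q^2 + q + 1)(q - 2) has the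
    parity of q, so the floor absorbs the parity term of [card_norm_ratio_img]. *)
Lemma card_scattered_norms :
  #|scattered_norms| = (((q ^ 2 + q + 1) * (q - 2)) %/ 2)%N.
Proof.
have -> : scattered_norms = fixed 3 :\: (0 |: (1 |: norm_ratio s @: deg6)).
  apply/setP=> n; rewrite !inE !negb_or andbC -!andbA; do !case: eqP => //=.
have n1 : 1 \notin norm_ratio s @: deg6.
  by apply/imsetP => -[w /[!inE] /(norm_ratio_neq01 s6) /andP[_ /eqP n] /esym].
have n0 : 0 \notin 1 |: norm_ratio s @: deg6.
  rewrite !inE eq_sym oner_eq0 /=.
  by apply/imsetP => -[w /[!inE] /(norm_ratio_neq01 s6) /andP[/eqP n _] /esym].
rewrite cardsDS; last first.
  apply/subsetP => n; rewrite !inE => /or3P[/eqP ->|/eqP ->|/imsetP[w _ ->]].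
  - by rewrite /= !rmorph0.
  - by rewrite /= !rmorph1.
  - by rewrite (norm_ratio_fixed3 s6).
rewrite card_fixed // !cardsU1 n1 n0.
have := card_norm_ratio_img; rewrite char2_even.
move: #|_| (q) q1 => N r r1 e.
have [u rE] : exists u, r = u.+2 by exists r.-2; lia.
have o : (odd ((r ^ 2 + r + 1) * (r - 2)) = odd r)%N.
  by rewrite oddM !oddD oddX oddB ?rE //=; case: odd.
have d := odd_double_half ((r ^ 2 + r + 1) * (r - 2)).
rewrite divn2; move: d; rewrite o; move: (_./2) => h d.
rewrite -mul2n in d.
have E : (r ^ 3 = (r ^ 2 + r + 1) * (r - 2) + r ^ 2 + r + 2)%N.
  by rewrite rE !subSS subn0; ring.
move: d e; case: odd => /=; lia.
Qed.

(** * Norms from F_{q^6} to K and the scatteredness criterion *)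

Lemma norm_surj n : n \in fixed 3 -> exists b, b * iter 3 s b = n.
Proof.
rewrite inE => n3; have [->|n0] := eqVneq n 0; first by exists 0; rewrite mul0r.
have [|_] := @unity_roots (q ^ 3).+1 (q ^ 3).-1.
  have -> : (q ^ 6 = q ^ 3 * q ^ 3)%N by rewrite -expnD.
  have : (0 < q ^ 3)%N by rewrite expn_gt0 ltnW.
  case: (q ^ 3)%N => // u _; rewrite /=; lia.
move=> /(_ n) [|x <-]; last by exists x; rewrite iter_sE exprS.
apply: (mulfI n0); rewrite -exprS prednK ?expn_gt0 ?(ltnW q1) //.
by rewrite -iter_sE (eqP n3) mulr1.
Qed.

(* Hilbert 90 for L / K, with the exponents shifted by s to match f_b. *)
Lemma norm_one y : y * iter 3 s y = 1 -> exists2 x, x != 0 & y = iter 4 s x / s x.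
Proof.
(* Here z is the preimage of y under s; writing z = s^3(x) / x and applying s gives the shifted
   form. *)
move=> ny; pose z := iter 5 s y.
have zE : s z = y by exact: s6.
have [|_] := @unity_roots (q ^ 3).-1 (q ^ 3).+1.
  have -> : (q ^ 6 = q ^ 3 * q ^ 3)%N by rewrite -expnD.
  have : (0 < q ^ 3)%N by rewrite expn_gt0 ltnW.
  case: (q ^ 3)%N => // u _; rewrite /=; lia.
move=> /(_ z) [|x xz].
  apply: (fmorph_inj s); rewrite rmorph1 rmorphXn zE.
  by rewrite exprS -iter_sE.
have y0 : y != 0 by apply: contra_eq_neq ny => ->; rewrite mul0r eq_sym oner_eq0.
have q3 : (1 < q ^ 3)%N by rewrite -(exp1n 3) ltn_exp2r.
have x0 : x != 0.
  apply: contraNneq y0 => x0; rewrite -zE -xz x0 expr0n.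
  by rewrite (_ : _ == 0%N = false) ?rmorph0 //; lia.
exists x => //; rewrite -zE -xz -[iter 4 s x]/(s (iter 3 s x)) -fmorph_div.
congr (s _); apply: (mulIf x0); rewrite mulfVK // -exprSr prednK ?(ltnW q3) //.
by rewrite iter_sE.
Qed.

Definition binom_map b x := b * s x + iter 4 s x.

Lemma norm_fixed3 b : b * iter 3 s b \in fixed 3.
Proof. by rewrite inE /= !rmorphM s6E mulrC. Qed.

Lemma exists_fixed i : i \in [:: 2; 3] -> exists2 w, w \in fixed i & s w != w.
Proof.
move=> i23; have /properP[_ [w wi w1]] : fixed 1 \proper fixed i.
  have i123 : i \in [:: 1; 2; 3] by rewrite in_cons i23 orbT.
  rewrite properEcard !card_fixed // ltn_exp2l // andbC.
  have -> : (1 < i)%N by move: i23; rewrite !inE => /orP[] /eqP ->.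
  by apply/subsetP => x; apply: fixed1_sub.
by exists w => //; rewrite inE in w1.
Qed.

Lemma binom_map_eigen b u w : binom_map b (w * u) = w * binom_map b u <->
  b * (s w - w) * s u + (iter 4 s w - w) * iter 4 s u = 0.
Proof.
have -> : b * (s w - w) * s u + (iter 4 s w - w) * iter 4 s u =
  binom_map b (w * u) - w * binom_map b u.
  by rewrite /binom_map /= !rmorphM; ring.
by split=> [->|/subr0_eq //]; rewrite subrr.
Qed.

(** The relation for (u, w) expresses b through w and s^4(u) / s(u). As s^3 exchanges s(u) and
    s^4(u), u drops out of the norm of b; conversely Hilbert 90 recovers u. *)
Lemma not_scattered_normP b :
  (exists u w, [/\ u != 0, s w != w & binom_map b (w * u) = w * binom_map b u]) <->
  b * iter 3 s b \notin scattered_norms.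
Proof.
have s4 x : iter 3 s (iter 4 s x) = s x by rewrite /= s6E.
rewrite inE norm_fixed3 /=; split.
  move=> [u [w [u0 w1 /binom_map_eigen e]]]; apply/negP => /and3P[/eqP n0 /eqP n1 nX].
  have su0 : s u != 0 by rewrite fmorph_eq0.
  have s4u0 : iter 4 s u != 0 by rewrite !fmorph_eq0.
  have w10 : s w - w != 0 by rewrite subr_eq0.
  have bE : b = - ((iter 4 s w - w) * iter 4 s u) / ((s w - w) * s u).
    apply: (mulIf (mulf_neq0 w10 su0)); rewrite mulfVK ?mulf_neq0 //.
    by apply: subr0_eq; rewrite -e; ring.
  have nE : b * iter 3 s b = (iter 4 s w - w) * (s w - iter 3 s w) /
      ((s w - w) * (iter 4 s w - iter 3 s w)).
    have -> : iter 3 s b = - ((s w - iter 3 s w) * s u) /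
        ((iter 4 s w - iter 3 s w) * iter 4 s u).
      rewrite -(s4 w) -(s4 u) {1}bE /=.
      by rewrite !(fmorph_div, rmorphN, rmorphM, rmorphB).
    have w43 : iter 4 s w - iter 3 s w != 0.
      by rewrite subr_eq0 /= !(inj_eq (fmorph_inj s)) -subr_eq0.
    rewrite {1}bE; move: w10 su0 s4u0.
    move: w43; move: (s w) (iter 3 s w) (iter 4 s w) (s u) (iter 4 s u).
    move=> w_1 w_3 w_4 u_1 u_4 w43 w10 su0 s4u0; field.
    by rewrite w43 w10 su0 s4u0.
  (* Outside degree 6, w in K forces norm 1 and w in F_{q^2} forces norm 0. *)
  have [w3|w3] := eqVneq (iter 3 s w) w.
    apply: n1; rewrite nE -[iter 4 s w]/(s (iter 3 s w)) w3 divff //.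
    by rewrite mulf_neq0.
  have [w2|w2] := eqVneq (iter 2 s w) w.
    apply: n0; rewrite nE -[iter 4 s w]/(iter 2 s (iter 2 s w)) !w2.
    by rewrite subrr !mul0r.
  case/negP: nX; apply/imsetP; exists w; first by rewrite inE; apply/andP.
  by rewrite nE /norm_ratio /cross_ratio [X in _ / X]mulrC.
rewrite !negb_and !negbK => /or3P[/eqP n0|/eqP n1|/imsetP[w]].
- have b0 : b = 0.
    by apply/eqP; move/eqP: n0; rewrite mulf_eq0 !fmorph_eq0 orbb.
  have [|w w2 w1] := exists_fixed (i := 2); first by [].
  exists 1, w; split=> //; first exact: oner_neq0.
  apply/binom_map_eigen; rewrite b0 !mul0r add0r.
  move: w2; rewrite inE => /eqP w2.
  by rewrite -[iter 4 s w]/(iter 2 s (iter 2 s w)) !w2 subrr mul0r.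
- have [|u u0 bE] := @norm_one (- b).
    by rewrite /= !rmorphN mulrNN.
  have [|w w3 w1] := exists_fixed (i := 3); first by [].
  exists u, w; split=> //.
  apply/binom_map_eigen; rewrite -[b]opprK bE.
  move: w3; rewrite inE => /eqP w3; rewrite -[iter 4 s w]/(s (iter 3 s w)) w3.
  have su0 : s u != 0 by rewrite fmorph_eq0.
  by field.
rewrite inE => Dw n; have h := degree6_distinct s6 Dw.
have h10 : s w - w != 0 := h 1 0 isT isT isT.
have h40 : iter 4 s w - w != 0 := h 4 0 isT isT isT.
have h43 : iter 4 s w - iter 3 s w != 0 := h 4 3 isT isT isT.
have h13 : s w - iter 3 s w != 0 := h 1 3 isT isT isT.
(* The required value of s^4(u) / s(u) has norm n / X(w) = 1. *)
have [|u u0 bE] := @norm_one (- b * (s w - w) / (iter 4 s w - w)).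
  rewrite {2}/iter !(fmorph_div, rmorphM, rmorphN, rmorphB).
  rewrite -/(iter 3 s b) -/(iter 3 s w) -/(iter 4 s w) -/(iter 3 s (iter 4 s w)) s4.
  transitivity ((b * iter 3 s b) * (((s w - w) * (iter 4 s w - iter 3 s w)) /
    ((iter 4 s w - w) * (s w - iter 3 s w)))).
    by field; rewrite h40 h13.
  rewrite n /norm_ratio /cross_ratio; field.
  by rewrite h10 h40 h43 h13.
exists u, w; split=> //; first exact: (degree6_nfix Dw).
apply/binom_map_eigen.
have su0 : s u != 0 by rewrite fmorph_eq0.
have -> : iter 4 s u = (- b * (s w - w) / (iter 4 s w - w)) * s u by rewrite bE mulfVK.
by field.
Qed.

(** * Equivalence of the U_b by comparison of q-polynomials *)

Lemma qpoly_eq0 (a : 'I_6 -> L) :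
  (forall x, \sum_(i < 6) a i * iter i s x = 0) -> forall i, a i = 0.
Proof.
move=> a0 i; pose p := \sum_(i < 6) a i *: 'X^(q ^ i) : {poly L}.
have -> : a i = p`_(q ^ i).
  rewrite coef_sum (bigD1 i) //= coefZ coefXn eqxx mulr1 big1 ?addr0 // => j ji.
  by rewrite coefZ coefXn eqn_exp2l // eq_sym val_eqE (negPf ji) mulr0.
suff -> : p = 0 by rewrite coef0.
apply/eqP; apply: contraT => p0.
(* A nonzero p of degree at most q^5 cannot vanish at all q^6 elements. *)
suff : (#|[set: L]| <= q ^ 5)%N by rewrite cardsT cardL leqNgt ltn_exp2l.
apply: (card_roots_le p0) => [|x _].
  apply: leq_trans (size_sum _ _ _) _; apply/bigmax_leqP => j _.
  apply: leq_trans (size_scale_leq _ _) _; rewrite size_polyXn ltnS.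
  by rewrite leq_exp2l // -ltnS.
rewrite rootE horner_sum -[X in _ == X](a0 x); apply/eqP.
by apply: eq_bigr => j _; rewrite !hornerE -iter_sE.
Qed.

(** The rows of the matrix are (a, c) and (d, e). The coefficients of s^0, s^1, s^4 give d = 0, e b
    = b' s(a), e = s^4(a); multiplying the second by its image under s^3 gives equal norms. *)
Lemma norm_of_equiv b b' a c d e : 
  (forall x, d * x + e * binom_map b x = binom_map b' (a * x + c * binom_map b x)) ->
  (d != 0) || (e != 0) ->
  b * iter 3 s b = b' * iter 3 s b'.
Proof.
move=> H de.
(* The coefficients of s^0 to s^5 in the difference of both sides, reduced with s^6 = 1. *)
pose co (i : 'I_6) := nth 0 [:: d; e * b - b' * s a;
  - (b' * s c * s b + iter 4 s c); 0; e - iter 4 s a;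
  - (b' * s c + iter 4 s c * iter 4 s b)] i.
have z : forall i, co i = 0.
  apply: qpoly_eq0 => x; rewrite !big_ord_recl big_ord0 /co /=.
  have := H x; rewrite /binom_map /= => /eqP; rewrite -subr_eq0 => /eqP e0.
  by rewrite -[RHS]e0 !(rmorphD, rmorphM) !s6E; ring.
have d0 : d = 0 := z 0.
have eE : e = iter 4 s a := subr0_eq (z (Ordinal (isT : 4 < 6)%N)).
have bE : e * b = b' * s a := subr0_eq (z (Ordinal (isT : 1 < 6)%N)).
have a0 : a != 0 by move: de; rewrite d0 eqxx eE /= !fmorph_eq0.
have sa0 : iter 4 s a * s a != 0 by rewrite mulf_neq0 ?fmorph_eq0.
have bE3 : s a * iter 3 s b = iter 3 s b' * iter 4 s a.
  by have := congr1 (iter 3 s) bE; rewrite eE /= !rmorphM !s6E.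
apply: (mulIf sa0).
transitivity ((e * b) * (s a * iter 3 s b)); first by rewrite eE; ring.
by rewrite bE bE3; ring.
Qed.

(** A diagonal map with entries a and s^4(a) suffices: it needs s^4(a) / s(a) = b' / b, which has
    norm 1 when b is nonzero. *)
Lemma equiv_of_norm b b' : b * iter 3 s b = b' * iter 3 s b' ->
  exists2 a, a != 0 & forall x, iter 4 s a * binom_map b x = binom_map b' (a * x).
Proof.
move=> n.
suff [a a0 e] : exists2 a, a != 0 & b * iter 4 s a = b' * s a.
  exists a => // x; rewrite /binom_map /= !rmorphM mulrDr mulrA [_ * b]mulrC.
  by rewrite [b * _]e mulrA.
have [b0|b0] := eqVneq b 0.
  exists 1; rewrite ?oner_neq0 // b0 mul0r; move/esym/eqP: n.
  by rewrite b0 mul0r mulf_eq0 !fmorph_eq0 orbb => /eqP->; rewrite mul0r.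
have n0 : b * iter 3 s b != 0 by rewrite mulf_neq0 ?fmorph_eq0.
have [|a a0 aE] := @norm_one (b' / b).
  by rewrite /= !fmorph_div mulf_div -[s (s (s b'))]/(iter 3 s b') -n divff.
have sa0 : s a != 0 by rewrite fmorph_eq0.
exists a => //; rewrite -(mulfVK sa0 (iter 4 s a)) -aE mulrA.
by rewrite [b * _]mulrC mulfVK.
Qed.

End FiniteField.

(** * From norms to subspaces and their equivalence classes *)

Section Classes.
Local Open Scope ring_scope.
Variables (F : finFieldType) (L : fieldExtType F).
Hypothesis dimL : \dim {:L} = 6.
Notation fL := (finvect_type L).
Notation V := (fL * fL)%type.
Notation q := #|F|.
Implicit Types (b x y w : fL) (u v : V).

Definition frob x : fL := x ^+ q.

Lemma frob_linear : linear frob.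
Proof. by have := @exp_card_linear F L 1; rewrite expn1. Qed.

Lemma frob_monoid_morphism : monoid_morphism frob.
Proof. by split=> [|x y]; rewrite /frob ?expr1n ?exprMn. Qed.

HB.instance Definition _ := GRing.isLinear.Build F fL fL *:%R frob frob_linear.
HB.instance Definition _ :=
  GRing.isMonoidMorphism.Build fL fL frob frob_monoid_morphism.

Definition frobenius : {rmorphism fL -> fL} := frob.
Notation s := frobenius.

Lemma frobeniusE x : s x = x ^+ q. Proof. by []. Qed.

Lemma card_fL : #|fL| = (q ^ 6)%N.
Proof.
have -> : #|fL| = #|({:fL})%VS| by apply: eq_card => x; rewrite memvf.
by rewrite card_vspace dimL.
Qed.

Lemma U_funE b x : U_fun b x = (x, binom_map s b x).
Proof. by rewrite /U_fun /binom_map (iter_sE frobeniusE). Qed.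

Lemma mem_U b v : (v \in U_ b) = (v.2 == binom_map s b v.1).
Proof.
apply/mem_UP/eqP => [[x ->]|e]; first by have [] := U_funE b x.
by exists v.1; rewrite -/(U_fun b v.1) U_funE -e; case: v {e}.
Qed.

Lemma dim_U b : \dim (U_ b) = 6.
Proof.
rewrite /U_ limg_dim_eq ?dimL //.
apply/eqP; rewrite -subv0; apply/subvP => x; rewrite memv_cap memv_ker lfunE /=.
by rewrite memv0 => /andP[_ /eqP []] ->.
Qed.

Lemma fixed_scalar x : s x = x -> exists k : F, x = k%:A.
Proof.
move=> sx; apply/vlineP; have := @Fermat's_little_theorem F fL 1%AS x.
by rewrite dimv1 expn1 -frobeniusE sx eqxx => ->.
Qed.

Lemma frobenius_scalar (k : F) : s k%:A = k%:A.
Proof. by rewrite /frobenius /= linearZ /= /frob expr1n. Qed.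

Lemma dim_le1P (W : {vspace V}) :
  reflect {in W &, forall u v, u != 0 -> v \in <[u]>%VS} (\dim W <= 1)%N.
Proof.
apply: (iffP idP) => [W1 u v uW vW u0|H].
  have uv : (<[u]> <= W)%VS by rewrite -memvE.
  suff /eqP -> : (<[u]> == W)%VS by [].
  by rewrite eqEdim uv dim_vline u0.
have [->|W0] := eqVneq W 0%VS; first by rewrite dimv0.
have u0 : vpick W != 0 by rewrite vpick0.
have <- : \dim <[vpick W]> = 1%N by rewrite dim_vline u0.
by apply/dimvS/subvP => v vW; apply: H; rewrite ?memv_pick.
Qed.

Lemma binom_mapZ b (k : F) x : binom_map s b (k *: x) = k *: binom_map s b x.
Proof.
have sk y : s (k *: y) = k *: s y by exact: linearZ.
by rewrite /binom_map /= !sk -scalerAr scalerDr.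
Qed.

(** Two vectors of U_b on one L-line, the first nonzero, differ by a factor w in L, and they are
    independent over F when w is not a scalar of F. *)
Lemma scatteredP b :
  reflect (~ exists x w, [/\ x != 0, s w != w &
                         binom_map s b (w * x) = w * binom_map s b x])
    (scattered (U_ b)).
Proof.
apply: (iffP forallP) => [H [x [w [x0 w1 e]]]|H v].
  have v0 : (x, binom_map s b x) != 0 :> V by apply: contraNneq x0 => -[->].
  have /implyP/(_ v0)/dim_le1P := H (x, binom_map s b x).
  move=> /(_ (x, binom_map s b x) (w * x, binom_map s b (w * x))).
  rewrite !memv_cap !mem_U /= !eqxx /=.
  have -> : (x, binom_map s b x) \in Lspan (x, binom_map s b x).
    by apply/mem_LspanP; exists 1; rewrite /Lscale !mul1r.
  have -> : (w * x, binom_map s b (w * x)) \in Lspan (x, binom_map s b x).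
    by apply/mem_LspanP; exists w; rewrite /Lscale e.
  move=> /(_ isT isT v0)/vlineP[k [wk _]].
  have wE : w = k%:A by apply: (mulIf x0); rewrite wk mulr_algl.
  by case/eqP: w1; rewrite wE frobenius_scalar.
apply/implyP => v0; apply/dim_le1P => -[x fx] [y fy].
rewrite !memv_cap !mem_U /= => /andP[/eqP -> /mem_LspanP[a [ex efx]]].
move=> /andP[/eqP -> /mem_LspanP[c [ey efy]]] u0.
have x0 : x != 0.
  apply: contraNneq u0 => ->; rewrite /binom_map /= !rmorph0 mulr0 addr0.
  exact: eqxx.
have a0 : a != 0 by apply: contraNneq x0 => a0; rewrite ex a0 mul0r.
have yE : y = (c / a) * x by rewrite ex ey mulrA mulfVK.
have fyE : binom_map s b y = (c / a) * binom_map s b x by rewrite efx efy mulrA mulfVK.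
have sw : s (c / a) = c / a.
  apply/eqP; apply: contraT => sw; case: H.
  by exists x, (c / a); split=> //; rewrite -yE.
have [k kE] := fixed_scalar sw.
have yk : y = k *: x by rewrite yE kE mulr_algl.
by apply/vlineP; exists k; rewrite yk binom_mapZ.
Qed.

Lemma max_scatteredE b :
  max_scattered (U_ b) = (b * iter 3 s b \in scattered_norms s).
Proof.
rewrite /max_scattered dim_U eqxx andbT.
apply/scatteredP/idP => [H|g].
  by apply: contraT => /(not_scattered_normP frobeniusE card_fL).
by move=> /(not_scattered_normP frobeniusE card_fL); rewrite g.
Qed.

Notation Uset b := [set v in U_ b].

Lemma GL2_equivE b b' :
  GL2_equiv L (Uset b) (Uset b') = (b * iter 3 s b == b' * iter 3 s b').
Proof.
apply/existsP/eqP => [[phi /andP[/GL2P phiL /eqP phiU]]|n].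
  have phi0 : phi 0 = 0.
    have Ls1 (u : V) : Lscale 1 u = u by case: u => x y; rewrite /Lscale !mul1r.
    have := phiL 1 0 0; rewrite !Ls1 addr0 -[X in X = _]addr0.
    by move/addrI/esym.
  pose a := (phi (1, 0)).1; pose d := (phi (1, 0)).2.
  pose c := (phi (0, 1)).1; pose e := (phi (0, 1)).2.
  have phiE x y : phi (x, y) = (a * x + c * y, d * x + e * y).
    have -> : (x, y) = Lscale x (1, 0) + (Lscale y (0, 1) + 0) :> V.
      rewrite /Lscale /= !mulr1 !mulr0 addr0.
      by congr pair; rewrite /= ?addr0 ?add0r.
    rewrite !phiL phi0 addr0 /Lscale /a /c /d /e.
    by rewrite ![x * _]mulrC ![y * _]mulrC.
  apply: (norm_of_equiv frobeniusE card_fL (a := a) (c := c) (d := d) (e := e)).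
    move=> x; have : phi (x, binom_map s b x) \in Uset b'.
      by rewrite -phiU imset_f // inE mem_U.
    by rewrite phiE inE mem_U /= => /eqP.
  (* If the second row vanished, (0, 1) would have no preimage under [phi]. *)
  apply: contraT; rewrite negb_or !negbK => /andP[/eqP d0 /eqP e0].
  have := permKV phi (0, 1); case: (phi^-1%g (0, 1)) => x y.
  rewrite phiE d0 e0 !mul0r addr0 => -[_ /eqP].
  by rewrite eq_sym oner_eq0.
have [a a0 aE] := equiv_of_norm frobeniusE card_fL n.
have s4a0 : iter 4 s a != 0 by rewrite !fmorph_eq0.
pose f (v : V) : V := (a * v.1, iter 4 s a * v.2).
have f_inj : injective f.
  by move=> [x y] [x' y'] [/(mulfI a0) -> /(mulfI s4a0) ->].
exists (perm f_inj); apply/andP; split.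
  apply/GL2P => t u v; rewrite !permE /f /Lscale /=.
  by congr pair; rewrite /= mulrDr mulrCA.
apply/eqP/setP => -[x y]; rewrite inE mem_U /=; apply/imsetP/eqP => [[[x' y']]|->].
  by rewrite inE mem_U permE /f /= => /eqP -> [-> ->].
exists (a^-1 * x, binom_map s b (a^-1 * x)); first by rewrite inE mem_U.
by rewrite permE /f /= aE mulVKf.
Qed.

(** By [GL2_equivE] the norm is a complete invariant of the class, and by [norm_surj] every
    admissible norm occurs. *)
Lemma card_classes :
  #|equivalence_partition (GL2_equiv L) (max_scattered_Us L)| =
  #|scattered_norms s|.
Proof.
pose nm b := b * iter 3 s b.
pose B := [set b : fL | max_scattered (U_ b)].
have UE : max_scattered_Us L = [set Uset b | b in B].
  by apply/setP => A; apply/imsetP/imsetP => -[b bB ->]; exists b => //;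
    move: bB; rewrite !inE.
have -> : scattered_norms s = nm @: B.
  apply/setP => n; apply/idP/imsetP => [gn|[b bB ->]].
    have [|b bn] := norm_surj frobeniusE card_fL (n := n).
      by move: gn; rewrite inE => /andP[].
    by exists b => //; rewrite inE max_scatteredE bn.
  by move: bB; rewrite inE max_scatteredE.
have -> : equivalence_partition (GL2_equiv L) (max_scattered_Us L) =
   (fun n => [set Uset b | b in B & nm b == n]) @: (nm @: B).
  rewrite /equivalence_partition UE -!imset_comp; apply: eq_in_imset => b bB /=.
  apply/setP => A; rewrite inE; apply/andP/imsetP => [[/imsetP[b' b'B ->]]|[b']].
    by rewrite GL2_equivE => e; exists b'; rewrite // inE b'B eq_sym.
  rewrite inE => /andP[b'B e] ->; rewrite imset_f // GL2_equivE; split=> //.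
  by rewrite eq_sym.
(* A class determines its norm: it contains U_b, and equal subspaces have equal norms. *)
rewrite card_in_imset // => _ _ /imsetP[b bB ->] /imsetP[b' b'B ->] /setP/(_ (Uset b)).
have -> : Uset b \in [set Uset b0 | b0 in B & nm b0 == nm b].
  by apply: imset_f; rewrite inE bB eqxx.
case/esym/imsetP => b0; rewrite inE => /andP[_ /eqP <-] e.
apply/eqP; rewrite -GL2_equivE e.
by have [-> _] := GL2_equiv_equivalence (Uset b0) (Uset b0) (Uset b0).
Qed.

End Classes.

Theorem theorem1p1 (q : nat) (F : finFieldType) (L : fieldExtType F)
    (hF : #|F| = q) (hL : \dim {:L} = 6) :
  #|equivalence_partition (GL2_equiv L) (max_scattered_Us L)| =
    ((q ^ 2 + q + 1) * (q - 2)) %/ 2.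
Proof.
rewrite (card_classes hL) -hF.
exact: (card_scattered_norms (frobeniusE (L := L)) (card_fL hL)).
Qed.
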